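(* Let $G$ be a finitely generated amenable group. If $0\neq\alpha\in\mathbb{C}G$, $0\neq\beta\in L^2(G)$ and $\alpha\beta=0$, then there exists $0\neq\gamma\in\mathbb{C}G$ such that $\alpha\gamma=0$.
   Context: $G$ is a discrete group, $\mathbb{C}G$ is its complex group algebra (finitely supported functions $G\to\mathbb{C}$ with convolution), and $L^2(G)=\{\beta:G\to\mathbb{C}\mid \sum_{g\in G}|\beta(g)|^2<\infty\}$, so that $\mathbb{C}G\subseteq L^2(G)$. $L^2(G)$ is a two-sided $\mathbb{C}G$-module by convolution; in particular, for $\alpha\in\mathbb{C}G$ and $\beta\in L^2(G)$, $(\alpha\beta)(g)=\sum_{h\in G}\alpha(h)\beta(h^{-1}g)$. Amenability: let $G$ be finitely generated with a finite symmetric generating set, and let $d$ be the associated word metric on $G$ for which right multiplications by elements of $G$ are isometries (i.e. $d(g,h)$ is the word length of $gh^{-1}$). $G$ is called amenable if it has an exhaustion $\mathcal{F}_1\subseteq\mathcal{F}_2\subseteq\cdots$, $\bigcup_{k=1}^\infty\mathcal{F}_k=G$, by finite (nonempty) subsets such that for every fixed $r\in\mathbb{N}$, $\lim_{k\to\infty}|\partial_r\mathcal{F}_k|/|\mathcal{F}_k|=0$, where $\partial_r\mathcal{F}_k=\{g\in\mathcal{F}_k\mid d(g,G\setminus\mathcal{F}_k)\le r\}$ (with the distance to the empty set being $+\infty$). *)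

(* Defs.v *)
(* The complex field is R[i] with R : realType. *)
From HB Require Import structures.
From mathcomp Require Import all_boot all_order all_algebra finmap complex.
From mathcomp Require Import all_classical all_reals all_analysis.

Set Implicit Arguments.
Unset Strict Implicit.
Unset Printing Implicit Defensive.

Import Order.TTheory GRing.Theory Num.Theory.
Import numFieldNormedType.Exports.

Local Open Scope classical_set_scope.
Local Open Scope ring_scope.

Definition symmetric_set (G : groupType) (S : {fset G}) : Prop :=
  forall s, s \in S -> (s^-1)%g \in S.

Definition generates (G : groupType) (S : {fset G}) : Prop :=
  forall H : {pred G},
    group_closed H -> {subset S <= H} -> forall g, g \in H.

(* The word metric, its distance to a set and [boundary] use extended reals so
   that [ereal_inf set0 = +oo] gives distance +oo to the empty set.  When S is
   symmetric and generates G, [word_length] is a natural number. *)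
Definition word_length (R : realType) (G : groupType) (S : {fset G}) (g : G) :
    \bar R :=
  ereal_inf [set ((size w)%:R : R)%:E | w in
    [set w : seq G | {subset w <= S} /\ (\prod_(s <- w) s)%g = g]].

Definition word_dist (R : realType) (G : groupType) (S : {fset G}) (g h : G) :
    \bar R :=
  word_length R S (g * h^-1)%g.

Definition dist_to (R : realType) (G : groupType) (S : {fset G}) (g : G)
    (A : set G) : \bar R :=
  ereal_inf [set word_dist R S g h | h in A].

Definition boundary (R : realType) (G : groupType) (S : {fset G}) (r : nat)
    (F : {fset G}) : {fset G} :=
  [fset g in F | `[< (dist_to R S g (~` [set` F]) <= (r%:R : R)%:E)%E >]]%fset.

Definition amenable (R : realType) (G : groupType) (S : {fset G}) : Prop :=
  exists F : nat -> {fset G},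
    [/\ forall k, F k != fset0%fset,
        forall k, (F k `<=` F k.+1)%fset,
        \bigcup_k [set` F k] = [set: G]
      & forall r : nat,
          (fun k => #|` boundary R S r (F k)|%:R / #|` F k|%:R : R) @ \oo
            --> (0 : R)].

Definition group_algebra (R : realType) (G : groupType) :=
  {fsfun G -> R[i] with 0}.

Definition L2 (R : realType) (G : groupType) : set (G -> R[i]) :=
  [set beta | (\esum_(g in [set: G]) (Normc.normc (beta g) ^+ 2)%:E < +oo)%E].

Definition convolution (R : realType) (G : groupType) (alpha : group_algebra R G)
    (beta : G -> R[i]) : G -> R[i] :=
  fun g => \sum_(h <- finsupp alpha) alpha h * beta (h^-1 * g)%g.

(* Main.v *)
(* Let M be the matrix indexed by a finite set F whose i-th row is the
   restriction to F of the right translate of beta by x0^-1 i, where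
   beta x0 <> 0.  Its diagonal is constantly beta x0 and its rows have squared
   norm at most B = ||beta||^2, so \rank M >= |F| |beta x0|^2 / B.  When F is a
   Foelner set this exceeds the number of points of its r-boundary, hence some
   combination f of the translates vanishes on the boundary but not on F.  Still
   alpha f = 0, and if r bounds the word lengths of the h^-1 k for h, k in the
   support of alpha, then cutting f off outside F leaves it in the kernel. *)
Require Import Defs.
From HB Require Import structures.
From mathcomp Require Import all_boot all_order all_algebra finmap complex.
From mathcomp Require Import all_classical all_reals all_analysis.

Set Implicit Arguments.
Unset Strict Implicit.
Unset Printing Implicit Defensive.

Import Order.TTheory GRing.Theory Num.Theory.
Local Open Scope ring_scope.

(** Let [N] consist of the columns of [M] in [D]. Since [\rank N <= #|D| < \rank M], the left kernel
    of [N] has larger dimension than that of [M], so some row of [kermx N] is not killed by [M]. *)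
Lemma row_vanishing_on (K : fieldType) m n (M : 'M[K]_(m, n)) (D : {set 'I_n}) :
  (#|D| < \rank M)%N ->
  exists2 u : 'rV[K]_m, u *m M != 0 & forall j, j \in D -> (u *m M) 0 j = 0.
Proof.
move=> ltDM; pose N := colsub (enum_val : 'I_#|D| -> 'I_n) M.
have /row_subPn[i nz] : ~~ (kermx N *m M <= (0 : 'M[K]_n))%MS.
  rewrite submx0; apply: contraTN ltDM => /eqP /sub_kermxP /mxrankS.
  rewrite !mxrank_ker -leqNgt => le_ker.
  have leMm := rank_leq_row M; have leND := rank_leq_col N.
  by apply: leq_trans leND; rewrite -(leq_sub2lE _ leMm).
rewrite submx0 in nz; exists (row i (kermx N)); first by rewrite -row_mul.
move=> j jD; have : row i (kermx N) *m N = 0 by rewrite -row_mul mulmx_ker row0.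
move/matrixP => /(_ 0 (enum_rank_in jD j)); rewrite !mxE => H; rewrite -[RHS]H.
by apply: eq_bigr => k _; rewrite [N _ _]mxE enum_rankK_in.
Qed.

(* Write M = A Q with orthonormal rows in Q: Cauchy-Schwarz bounds `|M i i|^2
   by ||row i A||^2 ||col i Q||^2, where ||row i A|| = ||row i M||, and the
   columns of Q have total squared norm \rank M. *)
Lemma diag_le_rank (C : numClosedFieldType) n (M : 'M[C]_n) (b B : C) :
  (forall i, \sum_j `|M i j| ^+ 2 <= B) -> (forall i, b <= `|M i i| ^+ 2) ->
  n%:R * b <= (\rank M)%:R * B.
Proof.
move=> leB leb.
have [r [A [Q [<- Qu MAQ]]]] : exists r (A : 'M[C]_(n, r)) (Q : 'M[C]_(r, n)),
    [/\ r = \rank M, Q \is unitarymx & M = A *m Q].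
  (* Gram-Schmidt on a basis of the row space of [M] provides [Q]. *)
  have /submxP[A MAQ] : (M <= schmidt (row_base M))%MS.
    by rewrite -(eq_row_base M) schmidt_sub.
  exists (\rank M), A, (schmidt (row_base M)); split=> //.
  by rewrite schmidt_unitarymx ?rank_leq_col.
have normA i : \sum_j `|M i j| ^+ 2 = dotmx (row i A) (row i A).
  transitivity ((M *m map_mx Num.conj M^T) i i).
    by rewrite mxE; apply: eq_bigr => j _; rewrite !mxE normCK.
  rewrite MAQ trmx_mul map_mxM /= -mulmxA [Q *m _]mulmxA.
  rewrite (unitarymxP Qu) mul1mx dotmxE !mxE.
  by apply: eq_bigr => j _; rewrite !mxE.
have normM i : `|M i i| ^+ 2 <= B * \sum_k `|Q k i| ^+ 2.
  (* [dotmx] conjugates its second argument, so the column of [Q] enters conjugated. *)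
  pose q := map_mx Num.conj (col i Q)^T.
  have -> : M i i = dotmx (row i A) q.
    rewrite MAQ dotmxE !mxE; apply: eq_bigr => k _.
    by rewrite !mxE conjCK.
  have -> : \sum_k `|Q k i| ^+ 2 = dotmx q q.
    rewrite dotmxE mxE; apply: eq_bigr => k _.
    by rewrite !mxE conjCK mulrC normCK.
  apply: le_trans (CauchySchwarz _ _ _) _.
  by rewrite ler_wpM2r ?dnorm_ge0 //; move: (leB i); rewrite normA.
have <- : \sum_i \sum_k `|Q k i| ^+ 2 = r%:R.
  rewrite exchange_big /= -[RHS](mxtrace1 C) -(unitarymxP Qu).
  apply: eq_bigr => k _; rewrite mxE; apply: eq_bigr => i _.
  by rewrite !mxE normCK.
rewrite mulrC mulr_natr -[X in _ *+ X]card_ord -sumr_const mulrC mulr_sumr.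
by apply: ler_sum => i _; exact: le_trans (leb i) (normM i).
Qed.

Lemma generates_word (G : groupType) (S : {fset G}) (g : G) :
  symmetric_set S -> generates S ->
  exists2 w : seq G, {subset w <= S} & (\prod_(s <- w) s)%g = g.
Proof.
move=> S_sym S_gen.
pose isword x := exists2 w : seq G, {subset w <= S} & (\prod_(s <- w) s)%g = x.
pose H : {pred G} := [pred x | `[< isword x >]].
suff HG : group_closed H.
  apply/asboolP/(S_gen H HG) => s sS; apply/asboolP; exists [:: s].
    by move=> x; rewrite inE => /eqP->.
  by rewrite big_seq1.
split; first by apply/asboolP; exists [::]; rewrite ?big_nil.
move=> x y /asboolP[v vS <-] /asboolP[w wS <-]; apply/asboolP.
(* The inverse of a word is the reversed word of inverses, whose letters lie in [S] by symmetry. *)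
exists (v ++ rev [seq s^-1%g | s <- w]).
  move=> s; rewrite mem_cat mem_rev => /orP[/vS//|/mapP[t /wS tS ->]].
  exact: S_sym.
rewrite big_cat /=; congr (_ * _)%g.
elim: w wS => [|s w IH] wS; first by rewrite !big_nil invg1.
rewrite /= rev_cons -cats1 big_cat big_seq1 big_cons invgM IH //.
by move=> t tw; apply: wS; rewrite inE tw orbT.
Qed.

Lemma mem_boundary (R : realType) (G : groupType) (S F : {fset G}) (r : nat)
    (w : seq G) (g h : G) :
  {subset w <= S} -> (size w <= r)%N -> (\prod_(s <- w) s = g * h^-1)%g ->
  g \in F -> h \notin F -> g \in boundary R S r F.
Proof.
move=> wS szw wE gF hF; rewrite /boundary !inE /= gF /=; apply/asboolP.
apply: (@le_trans _ _ (word_dist R S g h)).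
  by apply: ereal_inf_lbound; exists h => //=; apply/negP.
apply: (@le_trans _ _ ((size w)%:R : R)%:E).
  by apply: ereal_inf_lbound; exists w.
by rewrite lee_fin ler_nat.
Qed.

Lemma amenable_boundary_lt (R : realType) (G : groupType) (S : {fset G})
    (r : nat) (e : R) :
  amenable R S -> 0 < e ->
  exists F : {fset G}, #|` boundary R S r F|%:R < e * #|` F|%:R.
Proof.
move=> [F [F0 _ _ /(_ r) /cvgr0Pnorm_lt lim]] e0.
have [k _ /(_ k (leqnn k)) /= ltk] := lim e e0.
exists (F k); rewrite -ltr_pdivrMr ?ltr0n ?cardfs_gt0 ?F0 //.
by apply: le_lt_trans ltk; exact: ler_norm.
Qed.

Lemma L2_bounded_sum (R : realType) (G : groupType) (beta : G -> R[i]) :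
  L2 beta ->
  exists2 B : R, 0 < B &
    forall s : seq G, uniq s -> \sum_(x <- s) `|beta x| ^+ 2 <= B%:C%C.
Proof.
rewrite /L2 /= => betafin; set E := esum _ _ in betafin.
have E0 : (0 <= E)%E by apply: esum_ge0 => x _; rewrite lee_fin sqr_ge0.
have Efin : E \is a fin_num by rewrite ge0_fin_numE.
(* The added 1 makes the bound strictly positive, as it later serves as a denominator. *)
exists (fine E + 1); first by rewrite ltr_pwDr ?fine_ge0.
move=> s us.
have -> : \sum_(x <- s) `|beta x| ^+ 2 =
    (\sum_(x <- s) Normc.normc (beta x) ^+ 2)%:C%C.
  by rewrite rmorph_sum; apply: eq_bigr => x _; rewrite rmorphXn.
rewrite lecR (@le_trans _ _ (fine E)) ?lerDl //.
rewrite -lee_fin fineK // -sumEFin; apply: esum_ge.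
exists [set` s]%classic; first by split => //; exact: finite_seq.
by rewrite -fsbig_seq.
Qed.

(** Fix [g]. If every h^-1 g with h in the support of [alpha] lies in [F], the cutoff and [f] agree
    at all these points. Otherwise some k^-1 g lies outside [F]; the quotient of h^-1 g by k^-1 g is
    h^-1 k, of length at most [r], so each h^-1 g in [F] is a boundary point, where [f] vanishes. *)
Lemma convolution_cutoff (R : realType) (G : groupType) (S F : {fset G})
    (r : nat) (alpha : group_algebra R G) (f : G -> R[i]) :
  (forall h k, h \in finsupp alpha -> k \in finsupp alpha ->
     exists w : seq G, [/\ {subset w <= S}, (size w <= r)%N &
                   (\prod_(s <- w) s = h^-1 * k)%g]) ->
  convolution alpha f = (fun=> 0) ->
  (forall x, x \in boundary R S r F -> f x = 0) ->
  convolution alpha ([fsfun x in F => f x] : group_algebra R G) = (fun=> 0).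
Proof.
move=> words alphaf f0; apply/funext => g; rewrite /convolution.
have [/allP inF|/allPn[k ks kF]] :=
    boolP (all (fun h => (h^-1 * g)%g \in F) (finsupp alpha)).
  transitivity (convolution alpha f g); last by rewrite alphaf.
  apply: eq_big_seq => h hs.
  by rewrite fsfunE inF.
rewrite big_seq big1 // => h hs; rewrite fsfunE.
case: ifP => hF; last by rewrite mulr0.
have [w [wS szw wE]] := words h k hs ks.
rewrite f0 ?mulr0 //; apply: (mem_boundary R wS szw _ hF kF).
by rewrite wE invgM invgK mulgA mulgK.
Qed.

Theorem theorem1 (R : realType) (G : groupType) (S : {fset G})
  (S_sym : symmetric_set S) (S_gen : generates S) (G_amenable : amenable R S)
  (alpha : group_algebra R G) (beta : G -> R[i])
  (alpha_neq0 : (alpha : G -> R[i]) <> (fun=> 0))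
  (beta_L2 : L2 beta) (beta_neq0 : beta <> (fun=> 0))
  (alpha_beta : convolution alpha beta = (fun=> 0)) :
  exists2 gamma : group_algebra R G,
    (gamma : G -> R[i]) <> (fun=> 0) & convolution alpha gamma = (fun=> 0).
Proof.
have [x0 bx0] : exists x, beta x != 0.
  apply: contra_notP beta_neq0 => /forallNP b0; apply/funext => x.
  exact/eqP/negbNE/negP/b0.
have [r words] : exists r, forall h k, h \in finsupp alpha ->
    k \in finsupp alpha -> exists w : seq G, [/\ {subset w <= S}, (size w <= r)%N &
      (\prod_(s <- w) s = h^-1 * k)%g].
  have /choice[w wP] : forall g : G, exists w : seq G,
      {subset w <= S} /\ (\prod_(s <- w) s)%g = g.
    by move=> g; have [w] := generates_word g S_sym S_gen; exists w.
  pose gs := [seq (h^-1 * k)%g | h <- finsupp alpha, k <- finsupp alpha].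
  (* The support is finite, so the chosen words for all h^-1 k have bounded length. *)
  exists (\max_(g <- gs) size (w g)) => h k hs ks.
  have [wS wE] := wP (h^-1 * k)%g; exists (w (h^-1 * k)%g); split => //.
  by apply: (@leq_bigmax_seq _ gs xpredT (size \o w)) => //; apply: allpairs_f.
have [B B0 leB] := L2_bounded_sum beta_L2.
pose b := Normc.normc (beta x0) ^+ 2.
have bE : b%:C%C = `|beta x0| ^+ 2 by rewrite rmorphXn.
have b0 : 0 < b by rewrite -ltcR bE exprn_gt0 ?normr_gt0.
(* The ratio [b / B] is the proportion of |F| that the rank of [M] is bound to reach. *)
have [F ltF] := amenable_boundary_lt r G_amenable (divr_gt0 b0 B0).
pose e (i : 'I_#|` F|) : G := nth 1%g F i.
have e_inj : injective e.
  by move=> i j /eqP; rewrite nth_uniq ?fset_uniq // => /eqP/val_inj.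
have eF i : e i \in F by rewrite mem_nth.
have e_surj x : x \in F -> exists i, e i = x.
  move=> xF; have xi : (index x F < #|` F|)%N by rewrite index_mem.
  by exists (Ordinal xi); rewrite /e nth_index.
pose M : 'M[R[i]]_#|` F| := \matrix_(i, j) beta (e j * (e i)^-1 * x0)%g.
pose D := [set j | e j \in boundary R S r F].
have leD : (#|D| <= #|` boundary R S r F|)%N.
  rewrite cardE -(size_map e); apply: uniq_leq_size.
    by rewrite map_inj_uniq ?enum_uniq.
  by move=> _ /mapP[j jD ->]; rewrite mem_enum inE in jD.
have ltDM : (#|D| < \rank M)%N.
  have : #|` F|%:R * b%:C%C <= (\rank M)%:R * B%:C%C.
    apply: diag_le_rank => i; last by rewrite mxE mulgV mul1g bE.
    (* By injectivity, row [i] lists values of [beta] at distinct points, so [B] bounds its squared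
       norm. *)
    have inj_i : injective (fun y => y * (e i)^-1 * x0)%g.
      by move=> y z /mulIg/mulIg.
    have := leB [seq (y * (e i)^-1 * x0)%g | y <- F].
    rewrite map_inj_uniq // fset_uniq big_map (big_nth 1%g) big_mkord.
    move=> /(_ isT); apply: le_trans.
    by apply: ler_sum => j _; rewrite mxE.
  rewrite -!(rmorph_nat (real_complex R)) -!rmorphM lecR => le_rank.
  rewrite ltnNge; apply/negP => rankD; move: ltF.
  rewrite mulrAC ltr_pdivlMr // mulrC [b * _]mulrC ltNge => /negP; apply.
  apply: le_trans le_rank _; rewrite [B * _]mulrC ler_wpM2r ?(ltW B0) // ler_nat.
  exact: leq_trans rankD leD.
have [u uM0 uD] := row_vanishing_on ltDM.
(* [f] is defined on all of [G] and restricts on [F] to the row [u *m M]. *)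
pose f x := \sum_i u 0 i * beta (x * (e i)^-1 * x0)%g.
have fe j : f (e j) = (u *m M) 0 j.
  by rewrite mxE; apply: eq_bigr => i _; rewrite mxE.
exists [fsfun x in F => f x].
  have /rV0Pn[j uMj] := uM0.
  move=> /(congr1 (@^~ (e j))); rewrite fsfunE eF fe => uMj0.
  by rewrite uMj0 eqxx in uMj.
apply: (@convolution_cutoff _ _ S F r) => //.
  apply/funext => g; rewrite /convolution /f.
  under eq_bigr do rewrite mulr_sumr.
  rewrite exchange_big big1 //= => i _.
  (* Left convolution commutes with right translation. *)
  transitivity (u 0 i * convolution alpha beta (g * (e i)^-1 * x0)%g).
    rewrite /convolution mulr_sumr; apply: eq_bigr => h _.
    by rewrite mulrCA !mulgA.
  by rewrite alpha_beta mulr0.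
move=> x xF; have [j ej] : exists j, e j = x.
  by apply: e_surj; move: xF; rewrite !inE => /andP[].
by rewrite -ej fe uD // inE ej.
Qed.
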